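(* Let $f:X\to X$ be a continuous map on a topological space $X$, and let $\overline{f}:\mathcal{K}(X)\to\mathcal{K}(X)$, $\overline{f}(K):=f(K)$, be the induced map on the hyperspace of non-empty compact subsets of $X$ endowed with the Vietoris topology. Then: (a) The following statements are equivalent: (i) $f_{(N)}:X^N\to X^N$ is topologically recurrent for every $N \in \mathbb{N}$; (ii) $\overline{f}_{(N)}:\mathcal{K}(X)^N\to \mathcal{K}(X)^N$ is topologically recurrent for every $N \in \mathbb{N}$; (iii) $\overline{f}:\mathcal{K}(X)\to \mathcal{K}(X)$ is topologically recurrent. (b) The following statements are equivalent: (i) $f_{(N)}:X^N\to X^N$ is multiply recurrent for every $N \in \mathbb{N}$; (ii) $\overline{f}_{(N)}:\mathcal{K}(X)^N\to \mathcal{K}(X)^N$ is multiply recurrent for every $N \in \mathbb{N}$; (iii) $\overline{f}:\mathcal{K}(X)\to \mathcal{K}(X)$ is multiply recurrent. (c) Given any Furstenberg family $\mathcal{A} \subset \mathscr{P}(\mathbb{N}_0)$, the following statements are equivalent: (i) $f_{(N)}:X^N\to X^N$ is topologically $\mathcal{A}$-recurrent for every $N \in \mathbb{N}$; (ii) $\overline{f}_{(N)}:\mathcal{K}(X)^N\to \mathcal{K}(X)^N$ is topologically $\mathcal{A}$-recurrent for every $N \in \mathbb{N}$; (iii) $\overline{f}:\mathcal{K}(X)\to \mathcal{K}(X)$ is topologically $\mathcal{A}$-recurrent.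
   Context: $\mathbb{N}$ is the set of strictly positive integers and $\mathbb{N}_0=\mathbb{N}\cup\{0\}$; $\mathscr{P}(\mathbb{N}_0)$ is the power set of $\mathbb{N}_0$. Furstenberg family: a collection $\mathcal{A}\subset\mathscr{P}(\mathbb{N}_0)$ that is hereditarily upward (if $A\in\mathcal{A}$ and $A\subset B\subset\mathbb{N}_0$, then $B\in\mathcal{A}$) and such that $\varnothing\notin\mathcal{A}$. For a continuous self-map $g:Y\to Y$ of a topological space $Y$ and $N\in\mathbb{N}$, $g_{(N)}:Y^N\to Y^N$ denotes the $N$-fold direct product $g_{(N)}(y_1,\dots,y_N)=(g(y_1),\dots,g(y_N))$, where $Y^N$ carries the product topology. A continuous self-map $g:Y\to Y$ of a topological space $Y$ is called: - topologically recurrent if for every non-empty open $U\subset Y$ there exists some $n\in\mathbb{N}$ such that $g^n(U)\cap U\neq\varnothing$; - multiply recurrent if for every $\ell\in\mathbb{N}$ and every non-empty open $U\subset Y$ there exists some $n\in\mathbb{N}$ such that $U\cap g^{-n}(U)\cap g^{-2n}(U)\cap\cdots\cap g^{-\ell n}(U)\neq\varnothing$; - topologically $\mathcal{A}$-recurrent if for every non-empty open $U\subset Y$ the set $\{n\in\mathbb{N}_0\;;\;g^n(U)\cap U\neq\varnothing\}$ belongs to $\mathcal{A}$. $\mathcal{K}(X)$ is the set of all non-empty compact subsets of $X$. The Vietoris topology on $\mathcal{K}(X)$ has as basic open sets $\mathcal{V}(U_1,\dots,U_N)=\{K\in\mathcal{K}(X)\;;\;K\subset\bigcup_{j=1}^N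 U_j,\ K\cap U_j\neq\varnothing \text{ for all } 1\le j\le N\}$, where $N\in\mathbb{N}$ and $U_1,\dots,U_N$ are non-empty open subsets of $X$. The map $\overline{f}(K):=f(K)=\{f(x)\;;\;x\in K\}$ is continuous for this topology. *)

(* Defs.v *)
From HB Require Import structures.
From mathcomp Require Import all_boot all_order all_algebra.
From mathcomp Require Import all_classical all_reals all_analysis.

Set Implicit Arguments.
Unset Strict Implicit.
Unset Printing Implicit Defensive.

Local Open Scope classical_set_scope.

Record furstenberg_family (A : set (set nat)) : Prop := FurstenbergFamily {
  furstenberg_upward : forall B C : set nat, A B -> B `<=` C -> A C;
  furstenberg_set0 : ~ A set0
}.

Section Recurrence.
Context {Y : topologicalType}.

Definition topologically_recurrent (g : Y -> Y) :=
  forall U : set Y, open U -> U !=set0 ->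
    exists n : nat, (0 < n)%N /\ (iter n g @` U) `&` U !=set0.

Definition multiply_recurrent (g : Y -> Y) :=
  forall l : nat, (0 < l)%N ->
  forall U : set Y, open U -> U !=set0 ->
    exists n : nat, (0 < n)%N /\
      \bigcap_(j in [set j | (j <= l)%N]) (iter (j * n) g @^-1` U) !=set0.

Definition topologically_family_recurrent (A : set (set nat)) (g : Y -> Y) :=
  forall U : set Y, open U -> U !=set0 ->
    A [set n : nat | (iter n g @` U) `&` U !=set0].

End Recurrence.

(* [{ptws 'I_N -> Y}] is the N-fold power of Y with the product topology. *)
Definition product_map (Y : topologicalType) (N : nat) (g : Y -> Y) :
    {ptws 'I_N -> Y} -> {ptws 'I_N -> Y} :=
  fun y i => g (y i).

Record hyperspace (X : topologicalType) := Hyperspace {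
  hyperspace_set :> set X;
  hyperspace_compact : compact hyperspace_set;
  hyperspace_neq0 : hyperspace_set !=set0
}.

HB.instance Definition _ (X : topologicalType) := gen_eqMixin (hyperspace X).
HB.instance Definition _ (X : topologicalType) := gen_choiceMixin (hyperspace X).

Section Vietoris.
Context {X : topologicalType}.

(* A finite tuple of sets is encoded by its length [N] and a sequence [U], of
   which only the first [N] terms are used. *)
Definition vietoris_index : set (nat * (nat -> set X)) :=
  [set NU | (0 < NU.1)%N /\
            forall j, (j < NU.1)%N -> open (NU.2 j) /\ NU.2 j !=set0].

Definition vietoris_basic (NU : nat * (nat -> set X)) : set (hyperspace X) :=
  [set K | K `<=` \bigcup_(j in [set j | (j < NU.1)%N]) NU.2 j /\
           forall j, (j < NU.1)%N -> K `&` NU.2 j !=set0].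

Lemma vietoris_basic_cover :
  \bigcup_(NU in vietoris_index) vietoris_basic NU = setT.
Proof.
rewrite -subTset => K _; have [x Kx] := hyperspace_neq0 K.
exists (1%N, fun=> setT).
  by split=> // j _; split; [exact: openT | exists x].
by split=> [y Ky|j _]; [exists 0%N | exists x].
Qed.

Lemma vietoris_basic_join (NU MW : nat * (nat -> set X)) (K : hyperspace X) :
  vietoris_index NU -> vietoris_index MW ->
  vietoris_basic NU K -> vietoris_basic MW K ->
  exists PZ, [/\ vietoris_index PZ, vietoris_basic PZ K &
    vietoris_basic PZ `<=` vietoris_basic NU `&` vietoris_basic MW].
Proof.
case: NU MW => [N U] [M W] [/= N0 oU] [/= M0 oW] [/= KU KUj] [/= KW KWj].
pose UU := \bigcup_(j in [set j | (j < N)%N]) U j.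
pose WW := \bigcup_(j in [set j | (j < M)%N]) W j.
have oUU : open UU by apply: bigcup_open => j /oU[].
have oWW : open WW by apply: bigcup_open => j /oW[].
pose Z j := if (j < N)%N then U j `&` WW else W (j - N)%N `&` UU.
have ZU j : (j < N)%N -> Z j = U j `&` WW by rewrite /Z => ->.
have ZW j : Z (N + j)%N = W j `&` UU by rewrite /Z ltnNge leq_addr /= addKn.
have splitN (P : nat -> Prop) : (forall j, (j < N)%N -> P j) ->
    (forall j, (j < M)%N -> P (N + j)%N) -> forall j, (j < N + M)%N -> P j.
  move=> P1 P2 j jNM; have [/P1//|Nj] := ltnP j N.
  by rewrite -(subnKC Nj); apply: P2; rewrite ltn_subLR.
have KZ : forall j, (j < N + M)%N -> K `&` Z j !=set0.
  apply: splitN => j jlt.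
    by have [x [Kx Ux]] := KUj _ jlt; exists x; rewrite ZU //; do !split=> //; exact: KW.
  by have [x [Kx Wx]] := KWj _ jlt; exists x; rewrite ZW; do !split=> //; exact: KU.
exists ((N + M)%N, Z); split => /=.
- split=> /=; first by rewrite addn_gt0 N0.
  move=> j jlt; split; last by have [x [_ Zx]] := KZ _ jlt; exists x.
  move: j jlt; apply: splitN => j jlt.
    by rewrite ZU //; apply: openI => //; case: (oU _ jlt).
  by rewrite ZW; apply: openI => //; case: (oW _ jlt).
- split=> //= x Kx; have [j /= jN Ujx] := KU _ Kx.
  exists j => /=; first by rewrite ltn_addr.
  by rewrite ZU //; split=> //; exact: KW.
- move=> L [/= LZ LZj].
  have sZ j : (j < N + M)%N -> Z j `<=` UU `&` WW.
    move: j; apply: splitN => j jlt x.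
      by rewrite ZU // => -[Ux Wx]; split=> //; exists j.
    by rewrite ZW => -[Wx Ux]; split=> //; exists j.
  split; split=> /=.
  + by move=> x /LZ[j /= /sZ s /s[]].
  + move=> j jN; have [|x [Lx]] := LZj j; first by rewrite ltn_addr.
    by rewrite ZU // => -[Ux _]; exists x.
  + by move=> x /LZ[j /= /sZ s /s[]].
  + move=> j jM; have [|x [Lx]] := LZj (N + j)%N; first by rewrite ltn_add2l.
    by rewrite ZW => -[Wx _]; exists x.
Qed.

HB.instance Definition _ := isBaseTopological.Build (hyperspace X)
  vietoris_basic_cover (fun i j t Di Dj => @vietoris_basic_join i j t Di Dj).

End Vietoris.

Lemma hyperspace_image_compact (X : topologicalType) (f : X -> X)
  (cf : continuous f) (K : hyperspace X) : compact (f @` K).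
Proof.
apply: continuous_compact; last exact: hyperspace_compact.
exact: continuous_subspaceT.
Qed.

Lemma hyperspace_image_neq0 (X : topologicalType) (f : X -> X)
  (K : hyperspace X) : f @` K !=set0.
Proof. by have [x Kx] := hyperspace_neq0 K; exists (f x); exists x. Qed.

Definition induced_map (X : topologicalType) (f : X -> X)
    (cf : continuous f) (K : hyperspace X) : hyperspace X :=
  Hyperspace (@hyperspace_image_compact X f cf K) (hyperspace_image_neq0 f K).

(* Main.v *)
(* Everything reduces to "for every nonempty finite family of nonempty open sets
   there are suitably many common return times", which is recurrence of all the
   finite powers.  A family downstairs produces a finite compact set upstairs.
   Conversely, if U `&` f^-m V is nonempty for distinct members U, V of a
   family, replacing both by U `&` f^-m V loses no information: a return of
   this set is a return of U and of V.  After finitely many replacements no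
   orbit goes from one member to another, so a compact set that lies in, and
   meets every member of, the family can come back to this position only if
   every member returns to itself. *)
Require Import Defs.
From mathcomp Require Import all_boot all_order all_algebra.
From mathcomp Require Import all_classical all_reals all_analysis.

Local Open Scope classical_set_scope.

(** * Return times common to the three notions of recurrence *)

Section Returns.
Context {Y : topologicalType}.
Implicit Types (P : set (set nat)) (l : nat) (g : Y -> Y).

(** The index [j = 0] puts the base point itself in [U], so [l = 1] gives the ordinary return
    times. *)
Definition returns g l (U : set Y) : set nat :=
  [set n | exists x, forall j, (j <= l)%N -> U (iter (j * n) g x)].

Definition recurrent_along P l g :=
  forall U : set Y, open U -> U !=set0 -> P (returns g l U).

(** Product-free form of the recurrence of all finite powers: the members of [s] share the time [n],
    but each has its own base point. *)
Definition jointly_recurrent_along P l g :=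
  forall s : seq (set Y), s != [::] ->
    (forall V, V \in s -> open V /\ V !=set0) ->
    P [set n | forall V, V \in s -> returns g l V n].

Lemma returns1E g U : returns g 1 U = [set n | (iter n g @` U) `&` U !=set0].
Proof.
apply/seteqP; split=> n /=.
  move=> [x Ux]; exists (iter n g x); split; last first.
    by have := Ux 1%N; rewrite mul1n; exact.
  by exists x => //; exact: (Ux 0%N).
move=> [_ [[x Ux <-] Unx]]; exists x => -[|[|//]] _; first by [].
by rewrite mul1n.
Qed.

End Returns.

(** An equality between whole notions can be rewritten under the quantifier over [N]. *)
Lemma topologically_recurrentE : @topologically_recurrent = fun Y =>
  recurrent_along [set B | exists n, (0 < n)%N /\ B n] 1.
Proof.
apply/functional_extensionality_dep => Y; apply/funext => g; apply/propext.
by split=> + U oU U0 => /(_ U oU U0); rewrite returns1E.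
Qed.

Lemma topologically_family_recurrentE :
  @topologically_family_recurrent = fun Y P => recurrent_along P 1.
Proof.
apply/functional_extensionality_dep => Y; apply/funext => P; apply/funext => g.
by apply/propext; split=> + U oU U0 => /(_ U oU U0); rewrite returns1E.
Qed.

Lemma iter_product_map (Y : topologicalType) (N : nat) (g : Y -> Y) n y i :
  iter n (@product_map Y N g) y i = iter n g (y i).
Proof. by elim: n => //= n <-. Qed.

(** * Boxes in finite powers *)

Section Box.
Context {Y : topologicalType} {N : nat}.
Implicit Types (y : {ptws 'I_N -> Y}) (U : 'I_N -> set Y).

Definition box U : set {ptws 'I_N -> Y} := [set y | forall i, U i (y i)].

Lemma open_box U : (forall i, open (U i)) -> open (box U).
Proof.
move=> oU; rewrite openE => y Uy.
apply: (@filter_forall _ _ (fun i => [set z : {ptws 'I_N -> Y} | U i (z i)])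
  (nbhs y)) => i.
apply: (@proj_continuous _ (fun=> Y) i y).
by apply: open_nbhs_nbhs; split.
Qed.

(** The open-sided boxes around [y] generate a filter. The product topology is a supremum over the
    coordinates, so this filter converges to [y] once it does so in each coordinate. *)
Lemma nbhs_box y A : nbhs y A ->
  exists U, [/\ forall i, open (U i), forall i, U i (y i) & box U `<=` A].
Proof.
pose D := [set U : 'I_N -> set Y | forall i, open (U i) /\ U i (y i)].
have FF : Filter (filter_from D box).
  apply: filter_from_filter.
    by exists (fun=> setT) => i; split=> //; exact: openT.
  move=> U V DU DV; exists (fun i => U i `&` V i).
    move=> i; have [[oU Uy] [oV Vy]] := (DU i, DV i).
    by split=> //; exact: openI.
  by move=> z UVz; split=> i; case: (UVz i).
have Fy : filter_from D box --> y.
  apply/cvg_sup => i B; rewrite nbhsE => -[_ [[C oC <-] /= Cy] CB].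
  exists (fun k => if k == i then C else setT).
    by move=> k; case: eqP => [->|_]; split=> //; exact: openT.
  by move=> z /(_ i); rewrite eqxx => Cz; exact: CB.
by move=> /Fy[U DU UA]; exists U; split=> // i; case: (DU i).
Qed.

End Box.

(** A list of open sets is the list of sides of an open box, and every nonempty open set of the
    power contains such a box. The coordinates of a returning point can be chosen independently. *)
Lemma recurrent_productP (Y : topologicalType) (P : set (set nat)) l
    (g : Y -> Y) : (forall B C, P B -> B `<=` C -> P C) ->
  (forall N, (0 < N)%N -> recurrent_along P l (@product_map Y N g)) <->
  jointly_recurrent_along P l g.
Proof.
move=> Pup; split=> [rg s s0 os|rg N N0 A oA [y Ay]].
  pose U (i : 'I_(size s)) := nth setT s i.
  have Us i : U i \in s by rewrite mem_nth.
  have /choice[y Uy] i : exists x, U i x := (os _ (Us i)).2.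
  have sN : (0 < size s)%N by rewrite lt0n size_eq0.
  have oU : open (box U) by apply: open_box => i; case: (os _ (Us i)).
  apply: (Pup _ _ (rg _ sN _ oU (ex_intro _ y Uy))) => n [z Uz] V Vs.
  have iV : (index V s < size s)%N by rewrite index_mem.
  exists (z (Ordinal iV)) => j /Uz /(_ (Ordinal iV)).
  by rewrite iter_product_map /U /= nth_index.
have /nbhs_box[U [oU Uy UA]] : nbhs y A by apply: open_nbhs_nbhs.
pose s := [seq U i | i <- enum 'I_N].
have Us i : U i \in s by apply: map_f; rewrite mem_enum.
have s0 : s != [::].
  by rewrite -size_eq0 size_map size_enum_ord -lt0n.
apply: (Pup _ _ (rg s s0 _)) => [_ /mapP[i _ ->]|n rn].
  by split=> //; exists (y i).
have /choice[z zP] i := rn _ (Us i).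
by exists z => j jl; apply: UA => i; rewrite iter_product_map; exact: zP.
Qed.

(** * Vietoris basic sets and finite compact sets *)

Lemma vietoris_basic_open (X : topologicalType) (NU : nat * (nat -> set X)) :
  vietoris_index NU -> open (vietoris_basic NU).
Proof.
by move=> iNU; exists [set NU]; [move=> _ ->|rewrite bigcup_set1].
Qed.

Lemma vietoris_basic_sub (X : topologicalType) (A : set (hyperspace X)) :
  open A -> A !=set0 ->
  exists NU, vietoris_index NU /\ vietoris_basic NU `<=` A.
Proof.
move=> [D Dsub <-] [K [NU DNU _]]; exists NU; split; first exact: Dsub.
by move=> L ?; exists NU.
Qed.

Lemma hyperspace_finite (X : topologicalType) (N : nat) (x : nat -> X) :
  (0 < N)%N -> exists K : hyperspace X, hyperspace_set K = x @` `I_N.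
Proof.
move=> N0.
have cK : compact (x @` `I_N) by apply/finite_compact/finite_image/finite_II.
have K0 : x @` `I_N !=set0 by exists (x 0%N); exists 0%N.
by exists (Hyperspace cK K0).
Qed.

Lemma iter_induced_map (X : topologicalType) (f : X -> X) (cf : continuous f)
    n K :
  hyperspace_set (iter n (induced_map cf) K) = iter n f @` K.
Proof.
elim: n => [|n IHn] /=; first by rewrite image_id.
by rewrite IHn image_comp.
Qed.

(** * Transfer between [f] and its induced map *)

Section Hyperspace.
Context {X : topologicalType} {f : X -> X} (cf : continuous f).
Context {P : set (set nat)} (Pup : forall B C, P B -> B `<=` C -> P C).
Context (l : nat).

Lemma jointly_recurrent_induced :
  jointly_recurrent_along P l f ->
  jointly_recurrent_along P l (induced_map cf).
Proof.
move=> rf s s0 os.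
have /choice[c cP] : forall A, exists NU : nat * (nat -> set X), A \in s ->
    vietoris_index NU /\ vietoris_basic NU `<=` A.
  move=> A; have [/os[oA A0]|_] := boolP (A \in s).
    by have [NU] := vietoris_basic_sub _ _ oA A0; exists NU.
  by exists (0, fun=> set0).
(* All the open sets of [X] that occur in the basic sets chosen inside the members of [s]. *)
pose t := [seq (c A).2 k | A <- s, k <- iota 0 (c A).1].
have tP A k : A \in s -> (k < (c A).1)%N -> (c A).2 k \in t.
  by move=> As kc; apply/allpairsPdep; exists A, k; rewrite mem_iota.
have t0 : t != [::].
  have [A As] : exists A, A \in s.
    by case: s s0 {os cP t tP} => // A s; exists A; rewrite mem_head.
  by have := tP _ _ As (cP _ As).1.1; case: (t).
apply: (Pup _ _ (rf t t0 _)).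
  move=> V /allpairsPdep[A [k [As]]]; rewrite mem_iota /= => kc ->.
  exact: (cP _ As).1.2.
move=> n nt A As; have [[N0 _] sA] := cP A As.
have xP k : (k < (c A).1)%N -> returns f l ((c A).2 k) n.
  by move=> kc; apply/nt/tP.
have [x0 _] := xP _ N0.
have /choice[x {}xP] : forall k, exists x, (k < (c A).1)%N ->
    forall j, (j <= l)%N -> (c A).2 k (iter (j * n) f x).
  move=> k; have [/xP[x xk]|_] := ltnP k (c A).1; first by exists x.
  by exists x0.
(* One returning point for each open set of the basic set makes up the returning compact set. *)
have [K KE] := hyperspace_finite _ _ x N0.
exists K => j jl; apply: sA; split=> [y|k kc]; rewrite iter_induced_map KE.
  by move=> [_ [k kc <-] <-]; exists k => //; exact: xP.
exists (iter (j * n) f (x k)); split; last exact: xP.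
by exists (x k) => //; exists k.
Qed.

(** The case [m = 0] is included, so distinct members are disjoint. *)
Definition orbit_separated (s : seq (set X)) :=
  forall V W m x, V \in s -> W \in s -> V x -> W (iter m f x) -> V = W.

Lemma iter_continuous m : continuous (iter m f).
Proof.
elim: m => [|m IHm] x /=; first exact: cvg_id.
exact: (continuous_comp (IHm x) (cf _)).
Qed.

Lemma orbit_separated_refinement (s : seq (set X)) :
  s != [::] -> (forall V, V \in s -> open V /\ V !=set0) ->
  exists t, [/\ t != [::], forall W, W \in t -> open W /\ W !=set0,
    orbit_separated t &
    forall V, V \in s -> exists2 W, W \in t &
      exists m, forall x, W x -> V (iter m f x)].
Proof.
have [k] := ubnP (size s); elim: k s => // k IHk s sk s0 os.
have [sep|] := pselect (orbit_separated s).
  by exists s; split=> // V Vs; exists V => //; exists 0%N.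
move=> nsep.
have [V [W [m [x [Vs Ws Vx Wx VW]]]]] : exists V W m x,
    [/\ V \in s, W \in s, V x, W (iter m f x) & V != W].
  apply: contrapT => H; apply: nsep => V W m x Vs Ws Vx Wx.
  by have [//|VW] := eqVneq V W; case: H; exists V, W, m, x.
(* [Z] replaces both [V] and [W], so the list gets shorter and the induction on its length
   applies. *)
pose Z := V `&` iter m f @^-1` W; pose r := rem W (rem V s).
have Wr : W \in rem V s.
  by have := Ws; rewrite (perm_mem (perm_to_rem Vs)) inE eq_sym (negPf VW).
have [||t [t0 ot sept tP]] := IHk (Z :: r) _ isT.
- have : (0 < size (rem V s))%N by case: (rem V s) Wr.
  by rewrite /= !size_rem //; case: (size s) sk => [|[]].
- move=> U; rewrite inE => /predU1P[->|/mem_rem/mem_rem/os//].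
  split; last by exists x.
  apply: openI; first exact: (os _ Vs).1.
  by move/continuousP: (iter_continuous m); apply; exact: (os _ Ws).1.
exists t; split=> // U.
have [Y Yt [q YZ]] := tP Z (mem_head _ _).
rewrite (perm_mem (perm_to_rem Vs)) inE => /predU1P[->|].
  by exists Y => //; exists q => y /YZ[].
rewrite (perm_mem (perm_to_rem Wr)) inE => /predU1P[->|Ur].
  (* After [q] steps [Y] lies in [Z], and [m] further steps lead into [W]. *)
  by exists Y => //; exists (m + q)%N => y /YZ[_]; rewrite iterD.
by apply: tP; rewrite inE Ur orbT.
Qed.

Lemma recurrent_induced_jointly :
  recurrent_along P l (induced_map cf) -> jointly_recurrent_along P l f.
Proof.
move=> rf s s0 os.
have [t [t0 ot sept tP]] := orbit_separated_refinement _ s0 os.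
pose NU := (size t, nth setT t).
have iNU : vietoris_index NU.
  by split=> [|j jt]; [rewrite lt0n size_eq0|apply/ot/mem_nth].
have NU0 : vietoris_basic NU !=set0.
  have [_ [a _]] := ot _ (mem_nth setT iNU.1).
  have /choice[x xP] : forall k, exists x, (k < size t)%N -> nth setT t k x.
    move=> k; have [kt|_] := ltnP k (size t); last by exists a.
    by have [_ [x]] := ot _ (mem_nth setT kt); exists x.
  have [K KE] := hyperspace_finite _ _ x iNU.1.
  exists K; split=> [y|k kt]; rewrite KE.
    by move=> [k kt <-]; exists k => //; exact: xP.
  by exists (x k); split; [exists k|exact: xP].
apply: (Pup _ _ (rf _ (vietoris_basic_open _ _ iNU) NU0)) => n [K KP] V.
move=> /tP[W Wt [m WV]].
have [_ /(_ (index W t))] := KP _ (leq0n _).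
rewrite /= nth_index ?index_mem // => /(_ Wt)[x [Kx Wx]].
(* Iterates commute, so it is enough that the orbit of [x] is in [W] at time [j * n]. *)
exists (iter m f x) => j jl; rewrite -iterD addnC iterD; apply: WV.
have [+ _] := KP _ jl; rewrite iter_induced_map => /(_ (iter (j * n) f x)).
case=> [|k /= kt tk]; first by exists x.
(* The image of [K] is covered by [t], and separation leaves [W] as the only member that the orbit
   of [x] can reach. *)
by rewrite (sept _ _ _ _ Wt (mem_nth setT kt) Wx tk).
Qed.

Lemma recurrent_along_tfae :
  [<-> forall N : nat, (0 < N)%N ->
         recurrent_along P l (@product_map X N f);
       forall N : nat, (0 < N)%N ->
         recurrent_along P l (@product_map (hyperspace X) N (induced_map cf));
       recurrent_along P l (induced_map cf)].
Proof.
have [prodf prodk] := (recurrent_productP _ _ l f Pup,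
  recurrent_productP _ _ l (induced_map cf) Pup).
tfae.
- by move=> /prodf/jointly_recurrent_induced/prodk.
(* A one-element list avoids identifying the first power with the space. *)
- move=> /prodk rk U oU U0.
  apply: (Pup _ _ (rk [:: U] isT _)) => [V|n]; first by rewrite inE => /eqP->.
  by apply; rewrite mem_head.
- by move=> /recurrent_induced_jointly/prodf.
Qed.

End Hyperspace.

Theorem corollary3p3 (X : topologicalType) (f : X -> X) (cf : continuous f) :
  [/\ (* (a) *)
      [<-> forall N : nat, (0 < N)%N ->
             topologically_recurrent (@product_map X N f);
           forall N : nat, (0 < N)%N ->
             topologically_recurrent
               (@product_map (hyperspace X) N (induced_map cf));
           topologically_recurrent (induced_map cf)],
      (* (b) *)
      [<-> forall N : nat, (0 < N)%N ->
             multiply_recurrent (@product_map X N f);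
           forall N : nat, (0 < N)%N ->
             multiply_recurrent
               (@product_map (hyperspace X) N (induced_map cf));
           multiply_recurrent (induced_map cf)]
    & (* (c) *)
      forall A : set (set nat), furstenberg_family A ->
      [<-> forall N : nat, (0 < N)%N ->
             topologically_family_recurrent A (@product_map X N f);
           forall N : nat, (0 < N)%N ->
             topologically_family_recurrent A
               (@product_map (hyperspace X) N (induced_map cf));
           topologically_family_recurrent A (induced_map cf)]].
Proof.
pose P := [set B : set nat | exists n, (0 < n)%N /\ B n].
have Pup B C : P B -> B `<=` C -> P C.
  by move=> [n [n0 Bn]] BC; exists n; split=> //; exact: BC.
split; first by rewrite topologically_recurrentE; exact: recurrent_along_tfae.
(* Multiple recurrence unfolds to [recurrent_along P l] for all positive [l], so each implication is
   applied for one [l] at a time. *)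
- tfae=> h.
  + move=> N N0 l l0; have [fk _] := recurrent_along_tfae cf Pup l.
    by apply: (fk _ N N0) => M M0; exact: h.
  + move=> l l0; have [_ [k1 _]] := recurrent_along_tfae cf Pup l.
    by apply: k1 => M M0; exact: h.
  + move=> N N0 l l0; have [_ [_ kf]] := recurrent_along_tfae cf Pup l.
    exact: kf (h l l0) N N0.
- move=> A [Aup _]; rewrite topologically_family_recurrentE.
  exact: recurrent_along_tfae.
Qed.
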